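(* Let $A\in\mathbb{R}^{m\times n}$, let $\boldsymbol{x}\in\mathbb{R}^n$ be a signal whose support has size $k\ge 1$, let $\boldsymbol{w}\in\mathbb{R}^m$, and let $\boldsymbol{y}=A\boldsymbol{x}+\boldsymbol{w}$. Let $\epsilon\ge 0$, $\lambda_n>0$, $\sigma>0$. For $s\in[1,n]$ let $\rho_s=\rho_s(A)$ denote the $\ell_1$-constrained minimal singular value of $A$. In each item below, assume that the index of $\rho$ appearing there lies in $[1,n]$ and that the corresponding value of $\rho$ is positive. 1. (Basis Pursuit) If $\|\boldsymbol{w}\|_2\le\epsilon$, then any solution $\hat{\boldsymbol{x}}$ of $$\min_{\boldsymbol{z}\in\mathbb{R}^n}\|\boldsymbol{z}\|_1\quad\text{s.t.}\quad\|\boldsymbol{y}-A\boldsymbol{z}\|_2\le\epsilon$$ satisfies $$\|\hat{\boldsymbol{x}}-\boldsymbol{x}\|_2\le\frac{2\epsilon}{\rho_{4k}}.$$ 2. (Dantzig selector) If $\|A^T\boldsymbol{w}\|_\infty\le\lambda_n\sigma$, then any solution $\hat{\boldsymbol{x}}$ of $$\min_{\boldsymbol{z}\in\mathbb{R}^n}\|\boldsymbol{z}\|_1\quad\text{s.t.}\quad\|A^T(\boldsymbol{y}-A\boldsymbol{z})\|_\infty\le\lambda_n\sigma$$ satisfies $$\|\hat{\boldsymbol{x}}-\boldsymbol{x}\|_2\le\frac{4\sqrt{k}}{\rho_{4k}^2}\,\lambda_n\sigma.$$ 3. (LASSO) If $\|A^T\boldsymbol{w}\|_\infty\le\kappa\lambda_n\sigma$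 for some $\kappa\in(0,1)$, then any solution $\hat{\boldsymbol{x}}$ of $$\min_{\boldsymbol{z}\in\mathbb{R}^n}\frac12\|\boldsymbol{y}-A\boldsymbol{z}\|_2^2+\lambda_n\sigma\|\boldsymbol{z}\|_1$$ satisfies $$\|\hat{\boldsymbol{x}}-\boldsymbol{x}\|_2\le\frac{1+\kappa}{1-\kappa}\cdot\frac{2\sqrt{k}}{\rho_{4k/(1-\kappa)^2}^2}\,\lambda_n\sigma.$$
   Context: The $\ell_1$-sparsity level of a non-zero vector $\boldsymbol{x}\in\mathbb{R}^n$ is $s(\boldsymbol{x})=\|\boldsymbol{x}\|_1^2/\|\boldsymbol{x}\|_2^2$. For $s\in[1,n]$ (a real number) and a matrix $A\in\mathbb{R}^{m\times n}$, the $\ell_1$-constrained minimal singular value ($\ell_1$-CMSV) of $A$ is $$\rho_s(A)=\min_{\boldsymbol{x}\ne 0,\ s(\boldsymbol{x})\le s}\frac{\|A\boldsymbol{x}\|_2}{\|\boldsymbol{x}\|_2}.$$ The support of a vector is the set of indices of its non-zero components. ''Solution'' means a minimizer of the stated optimization problem. *)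

(* Defs.v *)
From mathcomp Require Import all_boot all_order all_algebra.
From mathcomp Require Import all_classical all_reals all_analysis.

Set Implicit Arguments.
Unset Strict Implicit.
Unset Printing Implicit Defensive.

Import Order.TTheory GRing.Theory Num.Theory.
Import numFieldNormedType.Exports.

Local Open Scope classical_set_scope.
Local Open Scope ring_scope.

Definition l1norm (R : realType) (n : nat) (x : 'cV[R]_n) : R :=
  \sum_(i < n) `|x i 0|.

Definition l2norm (R : realType) (n : nat) (x : 'cV[R]_n) : R :=
  Num.sqrt (\sum_(i < n) x i 0 ^+ 2).

(* [mx_norm] is the maximum of the absolute values of the entries. *)
Definition linfnorm (R : realType) (n : nat) (x : 'cV[R]_n) : R := mx_norm x.

Definition vsupp (R : realType) (n : nat) (x : 'cV[R]_n) : {set 'I_n} :=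
  finset (fun i => x i 0 != 0).

Definition l1_sparsity (R : realType) (n : nat) (x : 'cV[R]_n) : R :=
  l1norm x ^+ 2 / l2norm x ^+ 2.

(* The minimum defining the l1-CMSV is written as an infimum; [l1_cmsv_attained]
   and [l1_cmsv_lb] below show that it is a minimum as soon as 1 <= s and
   0 < n. *)
Definition l1_cmsv (R : realType) (m n : nat) (s : R) (A : 'M[R]_(m, n)) : R :=
  inf [set l2norm (A *m x) / l2norm x
      | x in [set x : 'cV[R]_n | x != 0 /\ l1_sparsity x <= s]].

Definition is_minimizer (R : realType) (T : Type) (feasible : set T)
    (f : T -> R) (z : T) : Prop :=
  feasible z /\ forall z', feasible z' -> f z <= f z'.

Definition basis_pursuit_sol (R : realType) (m n : nat) (A : 'M[R]_(m, n))
    (y : 'cV[R]_m) (eps : R) (xhat : 'cV[R]_n) : Prop :=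
  is_minimizer [set z | l2norm (y - A *m z) <= eps] (@l1norm R n) xhat.

Definition dantzig_sol (R : realType) (m n : nat) (A : 'M[R]_(m, n))
    (y : 'cV[R]_m) (mu : R) (xhat : 'cV[R]_n) : Prop :=
  is_minimizer [set z | linfnorm (A^T *m (y - A *m z)) <= mu]
    (@l1norm R n) xhat.

Definition lasso_sol (R : realType) (m n : nat) (A : 'M[R]_(m, n))
    (y : 'cV[R]_m) (mu : R) (xhat : 'cV[R]_n) : Prop :=
  is_minimizer [set: 'cV[R]_n]
    (fun z => 2^-1 * l2norm (y - A *m z) ^+ 2 + mu * l1norm z) xhat.

Section CmsvIsMin.
Variables (R : realType) (m n : nat).
Implicit Types (A : 'M[R]_(m, n)) (x : 'cV[R]_n).

Lemma l1normZ p (a : R) (x : 'cV[R]_p) : l1norm (a *: x) = `|a| * l1norm x.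
Proof. by rewrite mulr_sumr; apply: eq_bigr => i _; rewrite mxE normrM. Qed.

Lemma l2normZ p (a : R) (x : 'cV[R]_p) : l2norm (a *: x) = `|a| * l2norm x.
Proof.
rewrite /l2norm (eq_bigr (fun i => a ^+ 2 * x i 0 ^+ 2)).
  by rewrite -mulr_sumr sqrtrM ?sqr_ge0// sqrtr_sqr.
by move=> i _; rewrite mxE exprMn.
Qed.

Lemma l2norm_gt0 p (x : 'cV[R]_p) : x != 0 -> 0 < l2norm x.
Proof.
move=> x0; rewrite sqrtr_gt0 lt0r sumr_ge0 ?andbT; last first.
  by move=> i _; exact: sqr_ge0.
apply: contra x0 => /eqP /psumr_eq0P H; apply/eqP/matrixP => i j.
rewrite ord1 mxE; apply/eqP; rewrite -sqrf_eq0 H// => k _; exact: sqr_ge0.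
Qed.

Lemma l1_cmsv_lb A (s : R) x : x != 0 -> l1_sparsity x <= s ->
  l1_cmsv s A <= l2norm (A *m x) / l2norm x.
Proof.
move=> x0 xs; apply: ge_inf; last by exists x.
by exists 0 => _ [z _ <-]; rewrite divr_ge0// sqrtr_ge0.
Qed.

Lemma continuous_l1norm_tr : continuous (fun u : 'rV[R]_n => l1norm u^T).
Proof.
rewrite (_ : (fun u => _) = fun u : 'rV[R]_n => \sum_(i < n) `|u 0 i|).
  apply: continuous_big => [|i _ u]; first exact: add_continuous.
  apply: continuous_comp; last exact: norm_continuous.
  exact: (@coord_continuous R 1 n 0 i u).
by apply/funext => u; apply: eq_bigr => i _; rewrite mxE.
Qed.

Lemma continuous_l2norm_mulmx_tr p (B : 'M[R]_(p, n)) :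
  continuous (fun u : 'rV[R]_n => l2norm (B *m u^T)).
Proof.
rewrite (_ : (fun u => _) = fun u : 'rV[R]_n =>
    Num.sqrt (\sum_(i < p) (\sum_(j < n) B i j * u 0 j) ^+ 2)); last first.
  apply/funext => u; congr Num.sqrt; apply: eq_bigr => i _; rewrite mxE.
  by congr (_ ^+ 2); apply: eq_bigr => j _; rewrite mxE.
move=> u; apply: continuous_comp; last exact: sqrt_continuous.
move: u; apply: continuous_big => [|i _ u]; first exact: add_continuous.
apply: (@continuous_comp _ _ _ (fun u : 'rV[R]_n => \sum_(j < n) B i j * u 0 j)
  (fun r : R => r ^+ 2)); last exact: exprn_continuous.
move: u; apply: continuous_big => [|j _ u]; first exact: add_continuous.
apply: (@continuous_comp _ _ _ (fun u : 'rV[R]_n => u 0 j) ( *%R (B i j))).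
  exact: (@coord_continuous R 1 n 0 j u).
exact: mulrl_continuous.
Qed.

Lemma l1_cmsv_attained A (s : R) : (0 < n)%N -> 1 <= s ->
  exists x, [/\ x != 0, l1_sparsity x <= s &
    l1_cmsv s A = l2norm (A *m x) / l2norm x].
Proof.
move=> n0 s1.
pose K : set 'rV[R]_n :=
  (fun u => l2norm (1%:M *m u^T)) @^-1` [set r | r = 1] `&`
  (fun u => l1norm u^T ^+ 2) @^-1` [set r | r <= s].
have KE u : K u <-> l2norm u^T = 1 /\ l1norm u^T ^+ 2 <= s.
  by rewrite /K /= mul1mx.
have K0 : K !=set0.
  exists (delta_mx 0 (Ordinal n0)); apply: (KE _).2.
  rewrite /l2norm /l1norm; split.
    rewrite (bigD1 (Ordinal n0))//= big1 => [|i /negPf i0].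
      by rewrite !mxE !eqxx addr0 expr1n sqrtr1.
    by rewrite !mxE i0 andbF expr0n.
  rewrite (bigD1 (Ordinal n0))//= big1 => [|i /negPf i0].
    by rewrite !mxE !eqxx addr0 normr1 expr1n.
  by rewrite !mxE i0 andbF normr0.
have cK : compact K.
  apply: bounded_closed_compact.
    exists 1; split; first exact: real1.
    move=> M M1 u Ku; have [u1 _] := (KE u).1 Ku; apply: le_trans (ltW M1).
    rewrite (_ : `|u| = mx_norm u)// mx_normrE; apply/bigmax_leP; split=> //.
    move=> [i j] _ /=.
    rewrite ord1 -u1 /l2norm -sqrtr_sqr ler_wsqrtr// (bigD1 j)//= mxE lerDl.
    by apply: sumr_ge0 => k _; exact: sqr_ge0.
  apply: closedI; apply: preimage_closed.
  - by move=> u _; exact: continuous_l2norm_mulmx_tr.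
  - exact: closed_eq.
  - move=> u _; apply: (@continuous_comp _ _ _ (fun v : 'rV[R]_n => l1norm v^T)
      (fun r : R => r ^+ 2)); first exact: continuous_l1norm_tr.
    exact: exprn_continuous.
  - exact: closed_le.
have [u uK umin] := @compact_EVT_min _ R (fun u => l2norm (A *m u^T)) K K0 cK
  (continuous_subspaceT (@continuous_l2norm_mulmx_tr _ A)).
move: uK; rewrite inE => Ku; have [u1 us] := (KE u).1 Ku.
have u0 : u^T != 0.
  apply: contra_eq_neq u1 => ->; rewrite /l2norm big1.
    by rewrite sqrtr0 eq_sym oner_eq0.
  by move=> i _; rewrite mxE expr0n.
have uS : l1_sparsity u^T <= s by rewrite /l1_sparsity u1 expr1n divr1.
exists u^T; split => //; apply/eqP; rewrite eq_le l1_cmsv_lb//= u1 divr1.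
apply: lb_le_inf; first by eexists; exists u^T.
move=> _ [x [x0 xs] <-]; have xp := l2norm_gt0 x0.
have xn : `|(l2norm x)^-1| = (l2norm x)^-1 by rewrite ger0_norm// invr_ge0 ltW.
have := umin ((l2norm x)^-1 *: x)^T; rewrite trmxK -scalemxAr l2normZ xn.
rewrite [in leRHS]mulrC; apply; rewrite inE; apply: (KE _).2; rewrite trmxK.
rewrite l2normZ l1normZ xn mulVf ?gt_eqF//; split => //.
by rewrite exprMn exprVn mulrC.
Qed.

End CmsvIsMin.

(* Main.v *)
(** The error [h = xhat - x] lies in a cone around the support [S] of [x]:
    minimality of [xhat] gives [(1 - kappa) * |h_{~S}|_1 <= (1 + kappa) * |h_S|_1]
    (with [kappa = 0] for Basis Pursuit and the Dantzig selector), so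
    [|h|_1 <= 2 / (1 - kappa) * sqrt k * |h|_2] by Cauchy-Schwarz, and the l1-CMSV
    bounds [|h|_2] by [|A h|_2]. It remains to bound [|A h|_2] from above: by
    the constraints for the first two estimators, and for the LASSO directly by
    comparing objective values, without first-order optimality conditions. *)
Require Import Defs.
From mathcomp Require Import all_boot all_order all_algebra.
From mathcomp Require Import all_classical all_reals all_analysis.
From mathcomp Require Import ring lra.

Import Order.TTheory GRing.Theory Num.Theory.
Import numFieldNormedType.Exports.

Local Open Scope ring_scope.

(** * Euclidean and sup norm inequalities *)

Lemma l2norm_ge0 (R : realType) (p : nat) (v : 'cV[R]_p) : 0 <= l2norm v.
Proof. exact: sqrtr_ge0. Qed.

Lemma l2norm_sqr (R : realType) (p : nat) (v : 'cV[R]_p) :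
  l2norm v ^+ 2 = (v^T *m v) 0 0.
Proof.
rewrite sqr_sqrtr; last by apply: sumr_ge0 => i _; exact: sqr_ge0.
by rewrite mxE; apply: eq_bigr => i _; rewrite mxE expr2.
Qed.

Lemma l2norm_sqrB (R : realType) (p : nat) (u v : 'cV[R]_p) :
  l2norm (u - v) ^+ 2 = l2norm u ^+ 2 - 2 * (u^T *m v) 0 0 + l2norm v ^+ 2.
Proof.
rewrite !l2norm_sqr !mxE mulr_sumr -sumrB -big_split; apply: eq_bigr => i _ /=.
by rewrite !mxE; ring.
Qed.

(** Parallelogram law with the [u + v] term dropped. When both norms are at most [eps] it yields the
    [2 * eps] of the triangle inequality. *)
Lemma l2normB_sqr_le (R : realType) (p : nat) (u v : 'cV[R]_p) :
  l2norm (u - v) ^+ 2 <= 2 * (l2norm u ^+ 2 + l2norm v ^+ 2).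
Proof.
rewrite !l2norm_sqr !mxE -big_split mulr_sumr; apply: ler_sum => i _ /=.
by rewrite !mxE; have := sqr_ge0 (u i 0 + v i 0); lra.
Qed.

Lemma dotmx_le_linf_l1 (R : realType) (p : nat) (u v : 'cV[R]_p) :
  `|(u^T *m v) 0 0| <= linfnorm u * l1norm v.
Proof.
rewrite mxE mulr_sumr; apply: le_trans (ler_norm_sum _ _ _) _.
apply: ler_sum => i _; rewrite mxE normrM ler_wpM2r//.
rewrite /linfnorm mx_normrE.
exact: (le_bigmax _ (fun ij => `|u ij.1 ij.2|) (i, ord0)).
Qed.

Lemma linfnorm_ge0 (R : realType) (p : nat) (u : 'cV[R]_p) : 0 <= linfnorm u.
Proof. exact: (@normr_ge0 R 'cV[R]_p u). Qed.

Lemma linfnormB_le (R : realType) (p : nat) (u v : 'cV[R]_p) :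
  linfnorm (u - v) <= linfnorm u + linfnorm v.
Proof. exact: (@ler_normB R 'cV[R]_p u v). Qed.

(** Cauchy-Schwarz against the indicator of [S], obtained by summing [(|h_i| - t)^2 >= 0] over [S]
    for a free [t]. *)
Lemma sum_norm_le_sqrt_card (R : realType) (p : nat) (S : {set 'I_p})
    (h : 'cV[R]_p) :
  \sum_(i in S) `|h i 0| <= Num.sqrt #|S|%:R * l2norm h.
Proof.
set L := \sum_(i in S) _; set Q := \sum_(i in S) h i 0 ^+ 2.
have L0 : 0 <= L by apply: sumr_ge0.
have QS t : 2 * t * L <= Q + #|S|%:R * t ^+ 2.
  rewrite mulr_sumr [_%:R * t ^+ 2]mulr_natl -sumr_const /Q -big_split; apply: ler_sum => i _ /=.
  by have := sqr_ge0 (`|h i 0| - t); rewrite -(real_normK (num_real (h i 0))); nra.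
have LQ : L ^+ 2 <= #|S|%:R * Q.
  have [S0|S0] := eqVneq #|S| 0%N.
    rewrite S0 mul0r /L big_pred0 ?expr0n// => i.
    by rewrite (cards0_eq S0) inE.
  have Sp : 0 < #|S|%:R :> R by rewrite ltr0n lt0n.
  (* The optimal [t] is the mean of [|h_i|] over [S]. *)
  have := QS (L / #|S|%:R); rewrite -(ler_pM2l Sp).
  have -> : #|S|%:R * (2 * (L / #|S|%:R) * L) = 2 * L ^+ 2 :> R.
    by field; rewrite gt_eqF.
  have -> : #|S|%:R * (Q + #|S|%:R * (L / #|S|%:R) ^+ 2) = #|S|%:R * Q + L ^+ 2.
    by field; rewrite gt_eqF.
  lra.
rewrite -sqrtrM ?ler0n// -(ger0_norm L0) -sqrtr_sqr ler_wsqrtr//.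
apply: le_trans LQ _; rewrite ler_wpM2l ?ler0n// [leRHS](bigID (mem S))/= lerDl.
by apply: sumr_ge0 => i _; exact: sqr_ge0.
Qed.

(** * The l1 norm on and off the support *)

Lemma l1norm_split (R : realType) (p : nat) (S : {set 'I_p}) (h : 'cV[R]_p) :
  l1norm h = \sum_(i in S) `|h i 0| + \sum_(i | i \notin S) `|h i 0|.
Proof. exact: bigID. Qed.

(** Off the support of [x], [z - x] coincides with [z]; on it, the reverse triangle inequality
    applies. *)
Lemma l1norm_supp_gap (R : realType) (p : nat) (x z : 'cV[R]_p) :
  \sum_(i | i \notin vsupp x) `|(z - x) i 0|
    - \sum_(i in vsupp x) `|(z - x) i 0| <= l1norm z - l1norm x.
Proof.
rewrite (l1norm_split _ _ (vsupp x) z) (l1norm_split _ _ (vsupp x) x).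
have -> : \sum_(i | i \notin vsupp x) `|(z - x) i 0| =
    \sum_(i | i \notin vsupp x) `|z i 0|.
  by apply: eq_bigr => i; rewrite !inE negbK => /eqP xi; rewrite !mxE xi subr0.
have -> : \sum_(i | i \notin vsupp x) `|x i 0| = 0.
  by apply: big1 => i; rewrite !inE negbK => /eqP ->; rewrite normr0.
have : \sum_(i in vsupp x) `|x i 0| - \sum_(i in vsupp x) `|z i 0| <=
    \sum_(i in vsupp x) `|(z - x) i 0|.
  rewrite -sumrB; apply: ler_sum => i _; rewrite !mxE distrC.
  exact: lerB_dist.
lra.
Qed.

(** Adding [(1 - kappa) * |h_S|_1] to both sides of the cone condition leaves [2 * |h_S|_1] on the
    right. *)
Lemma l1norm_le_cone (R : realType) (p : nat) (S : {set 'I_p}) (kappa : R)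
    (h : 'cV[R]_p) :
  kappa < 1 ->
  (1 - kappa) * \sum_(i | i \notin S) `|h i 0| <=
    (1 + kappa) * \sum_(i in S) `|h i 0| ->
  l1norm h <= 2 / (1 - kappa) * Num.sqrt #|S|%:R * l2norm h.
Proof.
move=> k1 hcone; have k1' : 0 < 1 - kappa by rewrite subr_gt0.
rewrite -(ler_pM2l k1').
have -> : (1 - kappa) * (2 / (1 - kappa) * Num.sqrt #|S|%:R * l2norm h) =
    2 * (Num.sqrt #|S|%:R * l2norm h) by field; rewrite gt_eqF.
rewrite (l1norm_split _ _ S); have := sum_norm_le_sqrt_card _ _ S h.
lra.
Qed.

(** * Lower bounds on [A *m h] from the l1-CMSV *)

Lemma l1_cmsv_mul_le (R : realType) (m n : nat) (A : 'M[R]_(m, n)) (c : R)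
    (h : 'cV[R]_n) :
  0 <= c -> l1norm h <= c * l2norm h ->
  l1_cmsv (c ^+ 2) A * l2norm h <= l2norm (A *m h).
Proof.
move=> c0 hc; have [->|h0] := eqVneq h 0.
  have l20 p : l2norm (0 : 'cV[R]_p) = 0.
    by rewrite -(scale0r 0) l2normZ normr0 mul0r.
  by rewrite mulmx0 !l20 mulr0.
have hp := l2norm_gt0 h0; rewrite -ler_pdivlMr//; apply: l1_cmsv_lb => //.
rewrite /l1_sparsity ler_pdivrMr ?exprn_gt0// -exprMn.
by rewrite ler_sqr ?nnegrE// ?sumr_ge0// mulr_ge0// ltW.
Qed.

(** The index is the square of the constant in [l1norm_le_cone]; [kappa = 0] gives the [4 * k] of
    the first two estimators. *)
Lemma l1_cmsv_cone (R : realType) (m n : nat) (A : 'M[R]_(m, n))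
    (S : {set 'I_n}) (kappa : R) (h : 'cV[R]_n) :
  kappa < 1 ->
  (1 - kappa) * \sum_(i | i \notin S) `|h i 0| <=
    (1 + kappa) * \sum_(i in S) `|h i 0| ->
  l1_cmsv (4 * #|S|%:R / (1 - kappa) ^+ 2) A * l2norm h <= l2norm (A *m h).
Proof.
move=> k1 hcone; have -> : 4 * #|S|%:R / (1 - kappa) ^+ 2 =
    (2 / (1 - kappa) * Num.sqrt #|S|%:R) ^+ 2.
  by rewrite !exprMn sqr_sqrtr ?ler0n// exprVn; ring.
apply: l1_cmsv_mul_le; last exact: l1norm_le_cone.
by rewrite !mulr_ge0 ?sqrtr_ge0// invr_ge0 subr_ge0 ltW.
Qed.

(** Here [a] is the error norm and [b] that of its image under [A]: [(rho * a)^2 <= b^2 <= c * a],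
    and one factor [a] cancels. *)
Lemma le_of_sqr_le (R : realType) (rho a b c : R) :
  0 < rho -> 0 <= a -> rho * a <= b -> b ^+ 2 <= c * a -> 0 <= c ->
  a <= c / rho ^+ 2.
Proof.
move=> rho0 a0 hab hb c0; rewrite ler_pdivlMr ?exprn_gt0//.
have [->|an0] := eqVneq a 0; first by rewrite mul0r.
have ap : 0 < a by rewrite lt0r an0.
rewrite -(ler_pM2r ap); apply: le_trans hb.
have -> : a * rho ^+ 2 * a = (rho * a) ^+ 2 by ring.
have ra0 : 0 <= rho * a by rewrite mulr_ge0// ltW.
by rewrite ler_sqr ?nnegrE// (le_trans ra0).
Qed.

Theorem theorem1 (R : realType) (m n : nat) (A : 'M[R]_(m, n)) (x : 'cV[R]_n)
    (k : nat) (w y : 'cV[R]_m) (eps lambda sigma : R)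
    (hk : #|vsupp x| = k) (hk1 : (1 <= k)%N)
    (hy : y = A *m x + w)
    (heps : 0 <= eps) (hlambda : 0 < lambda) (hsigma : 0 < sigma) :
  [/\ 1 <= 4 * (k%:R : R) <= n%:R ->
      0 < l1_cmsv (4 * k%:R) A ->
      l2norm w <= eps ->
      forall xhat : 'cV[R]_n, basis_pursuit_sol A y eps xhat ->
        l2norm (xhat - x) <= 2 * eps / l1_cmsv (4 * k%:R) A,
      1 <= 4 * (k%:R : R) <= n%:R ->
      0 < l1_cmsv (4 * k%:R) A ->
      linfnorm (A^T *m w) <= lambda * sigma ->
      forall xhat : 'cV[R]_n, dantzig_sol A y (lambda * sigma) xhat ->
        l2norm (xhat - x) <=
          4 * Num.sqrt k%:R / l1_cmsv (4 * k%:R) A ^+ 2 * (lambda * sigma)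
    & forall kappa : R, 0 < kappa < 1 ->
      1 <= 4 * k%:R / (1 - kappa) ^+ 2 <= n%:R ->
      0 < l1_cmsv (4 * k%:R / (1 - kappa) ^+ 2) A ->
      linfnorm (A^T *m w) <= kappa * lambda * sigma ->
      forall xhat : 'cV[R]_n, lasso_sol A y (lambda * sigma) xhat ->
        l2norm (xhat - x) <=
          (1 + kappa) / (1 - kappa)
          * (2 * Num.sqrt k%:R / l1_cmsv (4 * k%:R / (1 - kappa) ^+ 2) A ^+ 2)
          * (lambda * sigma)].
Proof.
have residual z : y - A *m z = w - A *m (z - x).
  by rewrite hy mulmxBr opprB addrA [A *m x + w]addrC.
have mu0 : 0 < lambda * sigma by rewrite mulr_gt0.
have sk0 : 0 <= Num.sqrt k%:R :> R := sqrtr_ge0 _.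
have gap z := l1norm_supp_gap _ _ x z.
have cone0 z : l1norm z <= l1norm x ->
    (1 - 0) * \sum_(i | i \notin vsupp x) `|(z - x) i 0| <=
    (1 + 0) * \sum_(i in vsupp x) `|(z - x) i 0|.
  by have := gap z; lra.
have cmsv0 z : l1norm z <= l1norm x ->
    l1_cmsv (4 * k%:R) A * l2norm (z - x) <= l2norm (A *m (z - x)).
  move=> /cone0 /(l1_cmsv_cone _ _ _ A _ _ _ ltr01).
  by rewrite hk subr0 expr1n divr1.
(* The noise bounds thus make [x] feasible for the two constrained problems. *)
have x_residual : y - A *m x = w by rewrite residual subrr mulmx0 subr0.
split.
- move=> _ rho0 hw xhat [/= feas opt].
  have /cmsv0 hrho : l1norm xhat <= l1norm x.
    by apply: opt; rewrite /= x_residual.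
  rewrite ler_pdivlMr// mulrC; apply: le_trans hrho _.
  have -> : A *m (xhat - x) = w - (y - A *m xhat) by rewrite residual subKr.
  rewrite -ler_sqr ?nnegrE ?sqrtr_ge0 ?mulr_ge0//.
  apply: le_trans (l2normB_sqr_le _ _ _ _) _.
  have sqle u : l2norm u <= eps -> @l2norm R m u ^+ 2 <= eps ^+ 2.
    by move=> ue; rewrite ler_sqr ?nnegrE ?sqrtr_ge0.
  by have := sqle _ hw; have := sqle _ feas; rewrite exprMn; lra.
- move=> _ rho0 hw xhat [/= feas opt].
  have xle : l1norm xhat <= l1norm x by apply: opt; rewrite /= x_residual.
  have hl1 := l1norm_le_cone _ _ _ _ _ ltr01 (cone0 _ xle).
  rewrite hk subr0 divr1 in hl1.
  rewrite mulrAC; apply: le_of_sqr_le rho0 (l2norm_ge0 _ _ _) (cmsv0 _ xle) _ _; last first.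
    by rewrite !mulr_ge0// ltW.
  set h := xhat - x in hl1 *.
  (* [A *m h] is the noise minus the residual at [xhat], and [A^T] maps each to sup norm at most
     [lambda * sigma]. *)
  have hA : linfnorm (A^T *m (A *m h)) <= 2 * (lambda * sigma).
    have -> : A^T *m (A *m h) = A^T *m w - A^T *m (y - A *m xhat).
      by rewrite -mulmxBr residual subKr.
    by apply: le_trans (linfnormB_le _ _ _ _) _; lra.
  have -> : l2norm (A *m h) ^+ 2 = ((A^T *m (A *m h))^T *m h) 0 0.
    by rewrite l2norm_sqr [(A^T *m _)^T]trmx_mul trmxK mulmxA.
  apply: le_trans (ler_norm _) _; apply: le_trans (dotmx_le_linf_l1 _ _ _ _) _.
  apply: (@le_trans _ _ (2 * (lambda * sigma) * (2 * Num.sqrt k%:R * l2norm h))).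
    by apply: ler_pM => //; [exact: linfnorm_ge0|exact: sumr_ge0].
  by lra.
- move=> kappa /andP[ka0 ka1] _ rho0 hw xhat [_ opt].
  (* Expanding the square lets the [w] terms cancel, leaving the cross term bounded in [hwh]. *)
  have := opt x I; rewrite x_residual residual l2norm_sqrB.
  set h := xhat - x => {}opt.
  have hwh : (w^T *m (A *m h)) 0 0 <= kappa * lambda * sigma * l1norm h.
    have -> : w^T *m (A *m h) = (A^T *m w)^T *m h by rewrite trmx_mul trmxK mulmxA.
    apply: le_trans (ler_norm _) _; apply: le_trans (dotmx_le_linf_l1 _ _ _ _) _.
    by rewrite ler_wpM2r// sumr_ge0.
  set S1 := \sum_(i in vsupp x) `|h i 0|.
  set S2 := \sum_(i | i \notin vsupp x) `|h i 0|.
  (* Used twice: nonnegativity of the left side gives the cone condition, and dropping [S2] gives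
     the upper bound [Ahc]. *)
  have basic : l2norm (A *m h) ^+ 2 <=
      2 * (lambda * sigma) * ((1 + kappa) * S1 - (1 - kappa) * S2).
    have := ler_wpM2l (ltW mu0) (gap xhat); rewrite -/h -/S1 -/S2 => g.
    rewrite (l1norm_split _ _ (vsupp x)) -/S1 -/S2 in hwh.
    by lra.
  have hcone : (1 - kappa) * S2 <= (1 + kappa) * S1.
    rewrite -subr_ge0 -(pmulr_rge0 _ (mulr_gt0 (ltr0n _ 2) mu0)).
    exact: le_trans (sqr_ge0 _) basic.
  have := l1_cmsv_cone _ _ _ A _ _ _ ka1 hcone; rewrite hk => hrho.
  have S20 : 0 <= S2 by apply: sumr_ge0.
  have S1le := sum_norm_le_sqrt_card _ _ (vsupp x) h.
  rewrite hk -/S1 in S1le.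
  have k1' : 0 < 1 - kappa by rewrite subr_gt0.
  set c := 2 * (1 + kappa) * Num.sqrt k%:R * (lambda * sigma).
  have c0 : 0 <= c by rewrite !mulr_ge0// ?ltW// addr_gt0.
  have Ahc : l2norm (A *m h) ^+ 2 <= c * l2norm h.
    apply: le_trans basic _.
    have -> : c * l2norm h =
        2 * (lambda * sigma) * ((1 + kappa) * (Num.sqrt k%:R * l2norm h)).
      by rewrite /c; ring.
    apply: ler_wpM2l; first by rewrite mulr_ge0// ltW.
    apply: (@le_trans _ _ ((1 + kappa) * S1)).
      by rewrite gerBl mulr_ge0// ltW.
    by rewrite ler_wpM2l// addr_ge0// ltW.
  (* This bound is [c / rho ^+ 2]; the stated one carries a further factor
     [1 / (1 - kappa) >= 1]. *)
  apply: le_trans (le_of_sqr_le _ _ _ _ _ rho0 (l2norm_ge0 _ _ _) hrho Ahc c0) _.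
  set r := l1_cmsv _ _.
  have -> : (1 + kappa) / (1 - kappa) * (2 * Num.sqrt k%:R / r ^+ 2)
      * (lambda * sigma) = (c / r ^+ 2) / (1 - kappa) by rewrite /c; ring.
  rewrite ler_peMr//; first by rewrite divr_ge0// sqr_ge0.
  by rewrite invf_ge1//; lra.
Qed.
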